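(* Let $d\in\mathbb N$. For all $i\le d$, let $F_i$ be a reproducing kernel Hilbert space of real-valued functions on a set $D_i$, and let $S_i=\langle\cdot,h_i\rangle$ be a bounded linear functional on $F_i$ with unit norm and (pointwise) nonnegative representer $h_i\in F_i$. Assume that for each $i\le d$ there are functions $f_i,g_i\in F_i$ and a number $\alpha_i\in(0,1]$ such that $(h_i,f_i,g_i)$ is orthonormal in $F_i$ and $\alpha_i h_i=\sqrt{f_i^2+g_i^2}$ pointwise on $D_i$. Then the tensor product problem $\mathbf S_d=S_1\otimes\cdots\otimes S_d$ on $\mathbf F_d=F_1\otimes\cdots\otimes F_d$ satisfies for all $n\in\mathbb N$ $$e(n,\mathbf S_d)^2\ \ge\ 1-n\prod_{i=1}^d(1+\alpha_i^2)^{-1}.$$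
   Context: For a reproducing kernel Hilbert space (RKHS) $F$ of real-valued functions on a set $D$ and a continuous linear functional $S$ on $F$, the $n$th minimal worst case error is $$e(n,S)=\inf_{x_1,\dots,x_n\in D}\ \inf_{c\in\mathbb R^n}\ \sup_{\|f\|_F\le1}\Bigl|S(f)-\sum_{j=1}^n c_jf(x_j)\Bigr|.$$ Tensor products: if $F_i$ is a RKHS on $D_i$ with kernel $K_i$, then $\mathbf F_d=F_1\otimes\cdots\otimes F_d$ is the RKHS on $\mathbf D_d=D_1\times\cdots\times D_d$ with reproducing kernel $\mathbf K_d(x,y)=\prod_{i=1}^dK_i(x^i,y^i)$. If $S_i=\langle\cdot,h_i\rangle$ on $F_i$, then $\mathbf S_d=S_1\otimes\cdots\otimes S_d$ is the functional $\langle\cdot,\mathbf h_d\rangle$ on $\mathbf F_d$ with $\mathbf h_d(t)=h_1(t^1)\cdots h_d(t^d)$. *)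

(* Defs.v *)
From HB Require Import structures.
From mathcomp Require Import all_boot all_order all_algebra.
From mathcomp Require Import all_classical all_reals all_analysis.

Set Implicit Arguments.
Unset Strict Implicit.
Unset Printing Implicit Defensive.

Import Order.TTheory GRing.Theory Num.Theory.
Import numFieldNormedType.Exports.

Local Open Scope classical_set_scope.
Local Open Scope ring_scope.

(* A reproducing kernel Hilbert space of real-valued functions on D. Its
   elements form an abstract type rather than a set of functions D -> R, so that
   the norm and the completeness are those of completeNormedModType; by
   rkhs_eval_inj an element u is determined by the function rkhs_eval u, with
   which it is identified. *)
Record rkhs (R : realType) (D : Type) := RKHS {
  rkhs_sort :> completeNormedModType R ;
  rkhs_dot : {dot rkhs_sort for idfun} ;
  rkhs_normE : forall u : rkhs_sort, `|u| = Num.sqrt (rkhs_dot u u) ;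
  rkhs_eval : rkhs_sort -> D -> R ;
  rkhs_evalP : forall (a : R) (u v : rkhs_sort) (x : D),
    rkhs_eval (a *: u + v) x = a * rkhs_eval u x + rkhs_eval v x ;
  rkhs_eval_inj : injective rkhs_eval ;
  (* rkhs_section y is K(., y) *)
  rkhs_section : D -> rkhs_sort ;
  rkhs_reproducing : forall (u : rkhs_sort) (y : D),
    rkhs_dot u (rkhs_section y) = rkhs_eval u y
}.

Arguments rkhs_dot {R D} r.
Arguments rkhs_eval {R D r} u x.

Definition kernel (R : realType) (D : Type) (F : rkhs R D) (x y : D) : R :=
  rkhs_eval (rkhs_section F y) x.

(* <., h> *)
Definition dot_functional (R : realType) (D : Type) (F : rkhs R D) (h : F)
    (u : F) : R :=
  rkhs_dot F u h.

Definition functional_norm (R : realType) (D : Type) (F : rkhs R D)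
    (T : F -> R) : \bar R :=
  ereal_sup [set `|T u|%:E | u in [set u : F | `|u| <= 1]].

(* Extended real-valued because for n > 0 the infimum is +oo if D is empty. *)
Definition minimal_error (R : realType) (D : Type) (F : rkhs R D) (n : nat)
    (S : F -> R) : \bar R :=
  ereal_inf [set ereal_inf [set
      functional_norm (fun u : F => S u - \sum_(j < n) c j * rkhs_eval u (x j))
    | c in [set: 'I_n -> R]] | x in [set: 'I_n -> D]].

(* A reproducing kernel determines its Hilbert space of functions, so this
   characterizes the tensor product of the F i up to the choice of carrier. *)
Definition is_tensor_product (R : realType) (d : nat) (D : 'I_d -> Type)
    (F : forall i, rkhs R (D i)) (FF : rkhs R (forall i, D i)) : Prop :=
  forall x y : forall i, D i,
    kernel FF x y = \prod_(i < d) kernel (F i) (x i) (y i).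

(* The element of FF given by t |-> \prod_i h i (t i). It is unique by
   rkhs_eval_inj, and it exists whenever FF is the tensor product of the F i;
   the default value 0 is irrelevant in that case. *)
Definition tensor_elt (R : realType) (d : nat) (D : 'I_d -> Type)
    (F : forall i, rkhs R (D i)) (FF : rkhs R (forall i, D i))
    (h : forall i, F i) : FF :=
  xget 0 [set u : FF | forall t : forall i, D i,
    rkhs_eval u t = \prod_(i < d) rkhs_eval (h i) (t i)].

Arguments tensor_elt {R d D F} FF h.

(* The tensor product of the functionals <., h i>. *)
Definition tensor_functional (R : realType) (d : nat) (D : 'I_d -> Type)
    (F : forall i, rkhs R (D i)) (FF : rkhs R (forall i, D i))
    (h : forall i, F i) : FF -> R :=
  dot_functional (tensor_elt FF h).

Arguments tensor_functional {R d D F} FF h.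

(* Main.v *)
Require Import Defs.
From HB Require Import structures.
From mathcomp Require Import all_boot all_order all_algebra.
From mathcomp Require Import all_classical all_reals all_analysis.
From mathcomp Require Import ring lra complex.

Set Implicit Arguments.
Unset Strict Implicit.
Unset Printing Implicit Defensive.

Import Order.TTheory GRing.Theory Num.Theory.
Import numFieldNormedType.Exports.

Local Open Scope classical_set_scope.
Local Open Scope ring_scope.

(* The squared worst case error of sum_j c_j f(x_j) is
   ||U - sum_j c_j K(., x_j)||^2 = ||U||^2 - 2 T + Q, where U is the representer
   of the tensor product functional, T = sum_j c_j U(x_j) and
   Q = sum_(j, k) c_j c_k K(x_j, x_k). Since ||U|| = 1, it suffices to show
   n Q >= p T^2 for p = prod_i (1 + alpha_i^2). By Bessel's inequality and the
   Schur product theorem, K may be replaced by the product over i of the kernels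
     h_i(x) h_i(y) + f_i(x) f_i(y) + g_i(x) g_i(y)
       = h_i(x) h_i(y) (1 + alpha_i^2 Re (w_i(x) conj(w_i(y)))),
   where w_i = (f_i + i g_i) / (alpha_i h_i) has modulus 1. Up to the factors
   h_i, this product is the entrywise squared modulus of a positive semidefinite
   matrix B with diagonal entries sqrt p, so that the claim becomes the
   inequality (sum_j c_j B_jj)^2 <= n sum_(j, k) c_j c_k |B_jk|^2. *)

(** * Positive semidefinite matrices *)

Section PositiveSemidefinite.
Context {C : numClosedFieldType} {n : nat}.
Implicit Types (A B : 'I_n -> 'I_n -> C).

Definition psd A : Prop :=
  (forall j k, A k j = (A j k)^*) /\
  (forall z : 'I_n -> C, 0 <= \sum_j \sum_k z j * A j k * (z k)^*).

(** By the spectral theorem [A = P^* D P] with [P] unitary; the eigenvalues are nonnegative, so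
    [W = P^* sqrt D] is a factor. *)
Lemma psd_factor A : psd A -> exists W : 'I_n -> 'I_n -> C,
  forall j k, A j k = \sum_l W j l * (W k l)^*.
Proof.
move=> [A_herm A_ge0]; pose M := \matrix_(j, k) A j k.
have M_herm : M \is hermsymmx.
  by apply/is_hermitianmxP/matrixP => j k; rewrite expr0 scale1r !mxE A_herm.
have /hermitian_normalmx/orthomx_spectralP ME := M_herm.
have P_unit := spectral_unitarymx M.
set P := spectralmx M in P_unit ME; set D := spectral_diag M in ME.
rewrite invmx_unitary // in ME.
have DE : diag_mx D = P *m M *m map_mx Num.conj P^T.
  rewrite ME !mulmxA (unitarymxP P_unit) mul1mx -mulmxA (unitarymxP P_unit).
  by rewrite mulmx1.
(* [D 0 l] is the quadratic form of [A] at row [l] of [P]. *)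
have D_ge0 l : 0 <= D 0 l.
  have -> : D 0 l = diag_mx D l l by rewrite mxE eqxx.
  rewrite DE mxE; have := A_ge0 (P l); rewrite exchange_big /=.
  congr (0 <= _); apply: eq_bigr => k _; rewrite !mxE mulr_suml.
  by apply: eq_bigr => j _; rewrite !mxE.
exists (fun j l => (P l j)^* * sqrtC (D 0 l)) => j k.
have -> : A j k = M j k by rewrite mxE.
rewrite {1}ME mxE; apply: eq_bigr => l _.
rewrite mul_mx_diag !mxE rmorphM /= conjCK.
rewrite (conj_Creal (x := sqrtC _)) ?ger0_real ?sqrtC_ge0 //.
by rewrite mulrACA -expr2 sqrtCK; ring.
Qed.

(** Schur product theorem: with [A = W W^*], the form of the product at [z] is the sum over [l] of
    the forms of [B] at the vectors [z j * W j l]. *)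
Lemma psdM A B : psd A -> psd B -> psd (fun j k => A j k * B j k).
Proof.
move=> psdA [B_herm B_ge0]; have [A_herm _] := psdA.
split=> [j k|z]; first by rewrite A_herm B_herm rmorphM.
have [W AE] := psd_factor psdA.
have -> : \sum_j \sum_k z j * (A j k * B j k) * (z k)^* =
    \sum_l \sum_j \sum_k (z j * W j l) * B j k * (z k * W k l)^*.
  rewrite [RHS]exchange_big; apply: eq_bigr => j _ /=.
  rewrite [RHS]exchange_big; apply: eq_bigr => k _ /=.
  rewrite AE mulr_suml mulr_sumr mulr_suml; apply: eq_bigr => l _.
  by rewrite rmorphM; ring.
by apply: sumr_ge0 => l _; exact: B_ge0.
Qed.

Lemma psdD A B : psd A -> psd B -> psd (fun j k => A j k + B j k).
Proof.
move=> [A_herm A_ge0] [B_herm B_ge0].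
split=> [j k|z]; first by rewrite A_herm B_herm rmorphD.
have := addr_ge0 (A_ge0 z) (B_ge0 z); rewrite -big_split; congr (0 <= _).
by apply: eq_bigr => j _; rewrite -big_split; apply: eq_bigr => k _ /=; ring.
Qed.

Lemma psd_rank1 (v : 'I_n -> C) : psd (fun j k => v j * (v k)^*).
Proof.
split=> [j k|z]; first by rewrite rmorphM /= conjCK mulrC.
have -> : \sum_j \sum_k z j * (v j * (v k)^*) * (z k)^* =
    (\sum_j z j * v j) * (\sum_j z j * v j)^*.
  rewrite rmorph_sum mulr_suml; apply: eq_bigr => j _; rewrite mulr_sumr.
  by apply: eq_bigr => k _; rewrite rmorphM; ring.
exact: mul_conjC_ge0.
Qed.

Lemma eq_psd A B : A =2 B -> psd A -> psd B.
Proof.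
move=> AB [A_herm A_ge0]; split=> [j k|z]; first by rewrite -!AB.
have := A_ge0 z; congr (0 <= _).
by apply: eq_bigr => j _; apply: eq_bigr => k _; rewrite AB.
Qed.

Lemma psd_prod (I : Type) (r : seq I) (A : I -> 'I_n -> 'I_n -> C) :
  (forall i, psd (A i)) -> psd (fun j k => \prod_(i <- r) A i j k).
Proof.
move=> psdA; elim: r => [|i r IHr].
  apply: eq_psd (psd_rank1 (fun=> 1)) => j k.
  by rewrite big_nil rmorph1 mulr1.
by apply: eq_psd (psdM (psdA i) IHr) => j k; rewrite big_cons.
Qed.

(** Monotonicity of entrywise products in the Loewner order, by telescoping:
    [A A' - B B' = A (A' - B') + (A - B) B']. *)
Lemma psd_prodB (I : Type) (r : seq I) (A B : I -> 'I_n -> 'I_n -> C) :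
  (forall i, psd (B i)) -> (forall i, psd (fun j k => A i j k - B i j k)) ->
  psd (fun j k => \prod_(i <- r) A i j k - \prod_(i <- r) B i j k).
Proof.
move=> psdB psdAB; have psdA i : psd (A i).
  by apply: eq_psd (psdD (psdAB i) (psdB i)) => j k; rewrite subrK.
elim: r => [|i r IHr].
  apply: eq_psd (psd_rank1 (fun=> 0)) => j k.
  by rewrite !big_nil mul0r subrr.
apply: eq_psd (psdD (psdM (psdA i) IHr) (psdM (psdAB i) (psd_prod r psdB))).
by move=> j k; rewrite !big_cons; ring.
Qed.

(** Lagrange's identity: the difference of the two sides is half the sum of all
    [(x i - x j) ^+ 2]. *)
Lemma sqr_sum_le (I : finType) (x : I -> C) : (forall i, x i \is Num.real) ->
  (\sum_i x i) ^+ 2 <= #|I|%:R * \sum_i x i ^+ 2.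
Proof.
move=> x_real; rewrite -subr_ge0.
have -> : #|I|%:R * \sum_i x i ^+ 2 - (\sum_i x i) ^+ 2 =
    2^-1 * \sum_i \sum_j (x i - x j) ^+ 2.
  have E : \sum_i \sum_j (x i - x j) ^+ 2 =
      \sum_i \sum_(j : I) x i ^+ 2 + \sum_(i : I) \sum_j x j ^+ 2
      - \sum_i \sum_j (x i * x j) *+ 2.
    rewrite -big_split -sumrB; apply: eq_bigr => i _ /=.
    by rewrite -big_split -sumrB; apply: eq_bigr => j _ /=; ring.
  have E1 : \sum_i \sum_(j : I) x i ^+ 2 = #|I|%:R * \sum_i x i ^+ 2.
    by rewrite mulr_sumr; apply: eq_bigr => i _; rewrite sumr_const mulr_natl.
  have E2 : \sum_(i : I) \sum_j x j ^+ 2 = #|I|%:R * \sum_i x i ^+ 2.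
    by rewrite sumr_const mulr_natl.
  have E3 : \sum_i \sum_j (x i * x j) *+ 2 = (\sum_i x i) ^+ 2 *+ 2.
    rewrite expr2 mulr_suml -sumrMnl; apply: eq_bigr => i _.
    by rewrite mulr_sumr -sumrMnl.
  by rewrite E E1 E2 E3; field.
rewrite mulr_ge0 ?invr_ge0 ?ler0n //; apply: sumr_ge0 => i _.
by apply: sumr_ge0 => j _; rewrite real_exprn_even_ge0 ?rpredB.
Qed.

(* With B = W W^*, both sides are expressed by the n x n Hermitian matrix
   M = W^* diag(c) W: the left one is (tr M)^2, the right one n ||M||^2. *)
Lemma psd_diag_le B (c : 'I_n -> C) : psd B -> (forall j, c j \is Num.real) ->
  (\sum_j c j * B j j) ^+ 2 <=
  n%:R * \sum_j \sum_k c j * c k * (B j k * (B j k)^*).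
Proof.
move=> /psd_factor[W BE] c_real.
pose M l m := \sum_j (W j l)^* * c j * W j m.
have M_real l : M l l \is Num.real.
  apply: rpred_sum => j _; rewrite mulrAC rpredM //.
  by rewrite mulrC ger0_real ?mul_conjC_ge0.
have -> : \sum_j c j * B j j = \sum_l M l l.
  rewrite exchange_big; apply: eq_bigr => j _; rewrite BE mulr_sumr.
  by apply: eq_bigr => l _; ring.
have -> : \sum_j \sum_k c j * c k * (B j k * (B j k)^*) =
    \sum_l \sum_m M l m * (M l m)^*.
  under [RHS]eq_bigr => l _.
    under eq_bigr => m _.
      rewrite /M rmorph_sum mulr_suml.
      under eq_bigr => j _ do rewrite mulr_sumr.
      over.
    rewrite exchange_big; under eq_bigr => j _ do rewrite exchange_big /=.
    over.
  rewrite [RHS]exchange_big; apply: eq_bigr => j _ /=.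
  rewrite [RHS]exchange_big; apply: eq_bigr => k _ /=.
  rewrite BE rmorph_sum mulr_suml mulr_sumr exchange_big.
  apply: eq_bigr => l _ /=; rewrite !mulr_sumr; apply: eq_bigr => m _.
  rewrite !rmorphM /= !conjCK.
  by rewrite (conj_Creal (c_real k)); ring.
(* Cauchy-Schwarz for the diagonal of [M]; the squared moduli off the diagonal only increase the
   right-hand side. *)
have := sqr_sum_le M_real; rewrite card_ord => /le_trans; apply.
rewrite ler_wpM2l ?ler0n //; apply: ler_sum => l _.
rewrite (bigD1 l) //= (conj_Creal (M_real l)) -expr2 lerDl.
by apply: sumr_ge0 => m _; exact: mul_conjC_ge0.
Qed.
End PositiveSemidefinite.

(** * Real matrices and the product inequality *)

Section RealPositiveSemidefinite.
Context {R : rcfType} {n : nat}.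
Implicit Types (A B : 'I_n -> 'I_n -> R).
Local Notation toC := (real_complex R).

(** Symmetry is a separate condition, since a real quadratic form sees only the symmetric part of
    [A]. *)
Definition real_psd A : Prop :=
  (forall j k, A k j = A j k) /\
  (forall z : 'I_n -> R, 0 <= \sum_j \sum_k z j * A j k * z k).

Lemma conj_toC (x : R) : (toC x)^* = toC x.
Proof. by apply: conj_Creal; rewrite complex_real. Qed.

(** At [z = x + i y] the form is the sum of the forms at [x] and [y]; the cross terms cancel by
    symmetry. *)
Lemma real_psd_psd A : real_psd A -> psd (fun j k => toC (A j k)).
Proof.
move=> [A_sym A_ge0]; split=> [j k|z]; first by rewrite conj_toC A_sym.
pose x j := complex.Re (z j); pose y j := complex.Im (z j).
have zE j : z j = toC (x j) + 'i * toC (y j) by rewrite [LHS]complexE complexiE.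
suff -> : \sum_j \sum_k z j * toC (A j k) * (z k)^* =
    toC (\sum_j \sum_k x j * A j k * x k + \sum_j \sum_k y j * A j k * y k).
  by rewrite ler0c addr_ge0.
have -> : \sum_j \sum_k z j * toC (A j k) * (z k)^* =
    \sum_j \sum_k toC (x j * A j k * x k) +
    \sum_j \sum_k toC (y j * A j k * y k)
    + ('i * (\sum_j \sum_k toC (y j * A j k * x k)) -
       'i * (\sum_j \sum_k toC (x j * A j k * y k))).
  rewrite !mulr_sumr -!sumrB -!big_split; apply: eq_bigr => j _ /=.
  rewrite !mulr_sumr -!sumrB -!big_split; apply: eq_bigr => k _ /=.
  rewrite !zE rmorphD !rmorphM /= conjCi !conj_toC.
  ring: (sqrCi R[i]).
have -> : \sum_j \sum_k toC (y j * A j k * x k) =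
    \sum_j \sum_k toC (x j * A j k * y k).
  rewrite exchange_big; apply: eq_bigr => j _; apply: eq_bigr => k _.
  by rewrite A_sym mulrC mulrA mulrAC.
rewrite subrr addr0 rmorphD !rmorph_sum /=.
by congr (_ + _); apply: eq_bigr => j _; rewrite rmorph_sum.
Qed.

Lemma psd_real_psd A : psd (fun j k => toC (A j k)) -> real_psd A.
Proof.
move=> [A_herm A_ge0]; split=> [j k|z].
  by apply: (@complexI R); rewrite A_herm conj_toC.
rewrite -ler0c rmorph_sum /=; have := A_ge0 (fun j => toC (z j)).
congr (0 <= _); apply: eq_bigr => j _; rewrite rmorph_sum.
apply: eq_bigr => k _.
by rewrite conj_toC !rmorphM.
Qed.

Lemma eq_real_psd A B : A =2 B -> real_psd A -> real_psd B.
Proof.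
move=> AB /real_psd_psd psdA; apply: psd_real_psd.
by apply: eq_psd psdA => j k; rewrite AB.
Qed.

Lemma real_psdD A B :
  real_psd A -> real_psd B -> real_psd (fun j k => A j k + B j k).
Proof.
move=> /real_psd_psd psdA /real_psd_psd psdB; apply: psd_real_psd.
by apply: eq_psd (psdD psdA psdB) => j k; rewrite rmorphD.
Qed.

Lemma real_psd_rank1 (v : 'I_n -> R) : real_psd (fun j k => v j * v k).
Proof.
apply: psd_real_psd; apply: eq_psd (psd_rank1 (fun j => toC (v j))) => j k.
by rewrite conj_toC rmorphM.
Qed.

Lemma real_psd_prodB (I : Type) (r : seq I) (A B : I -> 'I_n -> 'I_n -> R) :
  (forall i, real_psd (B i)) ->
  (forall i, real_psd (fun j k => A i j k - B i j k)) ->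
  real_psd (fun j k => \prod_(i <- r) A i j k - \prod_(i <- r) B i j k).
Proof.
move=> real_psdB real_psdAB; apply: psd_real_psd.
apply: eq_psd (@psd_prodB _ _ _ r _ _ (fun i => real_psd_psd (real_psdB i)) _);
  last first.
- move=> i; apply: eq_psd (real_psd_psd (real_psdAB i)) => j k.
  by rewrite rmorphB; reflexivity.
- by move=> j k /=; rewrite rmorphB !rmorph_prod.
Qed.

(* With w_j = p_j + i q_j, s^2 + t^2 = 1 and 2 s t = a^2, the factors on the
   right are |b_jk|^2 for the positive semidefinite b_jk = s + t w_j conj(w_k),
   and b_jj^2 = (s + t)^2 = 1 + a^2. *)
Lemma prod_cos_ge (I : finType) (a : I -> R) (p q : I -> 'I_n -> R)
    (c : 'I_n -> R) :
  (forall i, 0 <= a i <= 1) -> (forall i j, p i j ^+ 2 + q i j ^+ 2 = 1) ->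
  \prod_i (1 + a i ^+ 2) * (\sum_j c j) ^+ 2 <=
  n%:R * \sum_j \sum_k c j * c k *
    \prod_i (1 + a i ^+ 2 * (p i j * p i k + q i j * q i k)).
Proof.
move=> a01 pq1.
(* The equations [s^2 + t^2 = 1] and [2 s t = a^2] amount to [(s + t)^2 = 1 + a^2] and
   [(s - t)^2 = 1 - a^2]; hence [u = s + t] and [v = s - t]. The bound [a <= 1] gives
   [v^2 = 1 - a^2]. *)
pose u i := Num.sqrt (1 + a i ^+ 2); pose v i := Num.sqrt (1 - a i ^+ 2).
have u2 i : u i ^+ 2 = 1 + a i ^+ 2.
  by rewrite sqr_sqrtr // addr_ge0 // sqr_ge0.
have v2 i : v i ^+ 2 = 1 - a i ^+ 2.
  rewrite sqr_sqrtr // subr_ge0; have /andP[? ?] := a01 i.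
  by rewrite expr_le1.
pose s i := (u i + v i) / 2; pose t i := (u i - v i) / 2.
have t_ge0 i : 0 <= t i.
  rewrite divr_ge0 // subr_ge0 ler_sqrt ?addr_ge0 ?sqr_ge0 //.
  by have := sqr_ge0 (a i); lra.
have s_ge0 i : 0 <= s i by rewrite divr_ge0 // addr_ge0 ?sqrtr_ge0.
pose w i j := toC (p i j) + 'i * toC (q i j).
have wJ i j : (w i j)^* = toC (p i j) - 'i * toC (q i j).
  by rewrite rmorphD rmorphM /= conjCi !conj_toC mulNr.
pose b i j k := toC (s i) + toC (t i) * (w i j * (w i k)^*).
pose r i := sqrtC (toC (t i)).
have psdb i : psd (b i).
  have rr : r i * (r i)^* = toC (t i).
    by rewrite conj_Creal ?ger0_real ?sqrtC_ge0 ?ler0c // -expr2 sqrtCK.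
  have ss : sqrtC (toC (s i)) * (sqrtC (toC (s i)))^* = toC (s i).
    by rewrite conj_Creal ?ger0_real ?sqrtC_ge0 ?ler0c // -expr2 sqrtCK.
  apply: eq_psd (psdD (psd_rank1 (fun=> sqrtC (toC (s i))))
                      (psd_rank1 (fun j => r i * w i j))) => j k.
  by rewrite /b /= ss [(r i * w i k)^*]rmorphM /= mulrACA rr.
have bdiag i j : b i j j = toC (u i).
  rewrite /b wJ /w.
  have -> : toC (s i) + toC (t i) * ((toC (p i j) + 'i * toC (q i j)) *
      (toC (p i j) - 'i * toC (q i j))) =
      toC (s i) + toC (t i) * toC (p i j ^+ 2 + q i j ^+ 2).
    by rewrite rmorphD !rmorphXn /=; ring: (sqrCi R[i]).
  by rewrite pq1 rmorph1 mulr1 -rmorphD; congr toC; rewrite /s /t; field.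
have bmod i j k : b i j k * (b i j k)^* =
    toC (1 + a i ^+ 2 * (p i j * p i k + q i j * q i k)).
  have E1 : s i ^+ 2 + t i ^+ 2 = 1.
    have -> : s i ^+ 2 + t i ^+ 2 = (u i ^+ 2 + v i ^+ 2) / 2.
      by rewrite /s /t; field.
    by rewrite u2 v2; field.
  have E2 : 2 * s i * t i = a i ^+ 2.
    have -> : 2 * s i * t i = (u i ^+ 2 - v i ^+ 2) / 2.
      by rewrite /s /t; field.
    by rewrite u2 v2; field.
  have ww l : w i l * (w i l)^* = 1.
    rewrite wJ /w -[RHS](rmorph1 toC) -(pq1 i l) rmorphD !rmorphXn /=.
    by ring: (sqrCi R[i]).
  have wjk : w i j * (w i k)^* + (w i j)^* * w i k =
      toC (2 * (p i j * p i k + q i j * q i k)).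
    rewrite !(rmorphD toC, rmorphM toC) !wJ /w /=.
    by ring: (sqrCi R[i]).
  have bJ : (b i j k)^* = toC (s i) + toC (t i) * ((w i j)^* * w i k).
    rewrite rmorphD /= [(toC (t i) * _)^*]rmorphM /=.
    by rewrite [(w i j * _)^*]rmorphM /= !conj_toC conjCK.
  rewrite bJ /b -{1}E1 -E2.
  have -> : s i ^+ 2 + t i ^+ 2 +
      2 * s i * t i * (p i j * p i k + q i j * q i k) =
      s i ^+ 2 + s i * t i * (2 * (p i j * p i k + q i j * q i k)) + t i ^+ 2.
    by ring.
  move: wjk (ww j) (ww k); move: (2 * _) => X wjk wwj wwk.
  rewrite !(rmorphD toC) (rmorphM toC (s i * _)) (rmorphM toC (s i)).
  rewrite !(rmorphXn toC) /= -wjk.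
  by ring: wwj wwk.
have c_real j : toC (c j) \is Num.real by rewrite complex_real.
(* The product of the [b i] has constant diagonal [\prod_i u i], whose square is
   [\prod_i (1 + a i ^+ 2)]. *)
have := psd_diag_le (psd_prod (index_enum I) psdb) c_real.
have -> : \sum_j toC (c j) * \prod_i b i j j = toC ((\prod_i u i) * \sum_j c j).
  rewrite mulr_sumr rmorph_sum; apply: eq_bigr => j _.
  by rewrite rmorphM rmorph_prod mulrC; congr (_ * _); apply: eq_bigr.
have -> : \sum_j \sum_k toC (c j) * toC (c k) *
    ((\prod_i b i j k) * (\prod_i b i j k)^*) =
    toC (\sum_j \sum_k c j * c k *
    \prod_i (1 + a i ^+ 2 * (p i j * p i k + q i j * q i k))).
  rewrite rmorph_sum; apply: eq_bigr => j _; rewrite rmorph_sum.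
  apply: eq_bigr => k _; rewrite !rmorphM rmorph_prod; congr (_ * _).
  by rewrite rmorph_prod -big_split; apply: eq_bigr => i _; exact: bmod.
rewrite -rmorphXn -(rmorph_nat toC) -rmorphM lecR exprMn -prodrXl.
by under eq_bigr do rewrite u2.
Qed.

(** Each [K i] dominates a kernel [M i] of rank at most three. Writing [(f, g)] in polar form with
    radius [a h] turns [M i] into the factor of [prod_cos_ge] times values of [h], which are
    absorbed into the coefficients [c]. *)
Lemma prod_quadratic_ge (I : finType) (a : I -> R) (h f g : I -> 'I_n -> R)
    (K : I -> 'I_n -> 'I_n -> R) (c : 'I_n -> R) :
  (forall i, 0 < a i <= 1) -> (forall i j, 0 <= h i j) ->
  (forall i j, a i * h i j = Num.sqrt (f i j ^+ 2 + g i j ^+ 2)) ->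
  (forall i, real_psd (fun j k =>
    K i j k - (h i j * h i k + f i j * f i k + g i j * g i k))) ->
  \prod_i (1 + a i ^+ 2) * (\sum_j c j * \prod_i h i j) ^+ 2 <=
  n%:R * \sum_j \sum_k c j * c k * \prod_i K i j k.
Proof.
move=> a01 h_ge0 hE psdK.
(* [(p, q)] is the direction of [(f, g)]. Where [h] vanishes, so do [f] and [g], and the default
   [(1, 0)] keeps [p^2 + q^2 = 1]. *)
pose p i j := if h i j == 0 then 1 else f i j / (a i * h i j).
pose q i j := if h i j == 0 then 0 else g i j / (a i * h i j).
have a0 i : a i != 0 by have /andP[/lt0r_neq0] := a01 i.
have fg i j : f i j ^+ 2 + g i j ^+ 2 = (a i * h i j) ^+ 2.
  by rewrite hE sqr_sqrtr // addr_ge0 // sqr_ge0.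
have fE i j : f i j = a i * h i j * p i j.
  rewrite /p; case: eqP => [h0|/eqP h0]; last first.
    by rewrite mulrC divfK // mulf_neq0.
  have := fg i j; rewrite h0 !mulr0 mul0r expr0n /= => /eqP.
  by rewrite paddr_eq0 ?sqr_ge0 // !sqrf_eq0 => /andP[/eqP].
have gE i j : g i j = a i * h i j * q i j.
  rewrite /q; case: eqP => [h0|/eqP h0]; last first.
    by rewrite mulrC divfK // mulf_neq0.
  have := fg i j; rewrite h0 !mulr0 expr0n /= => /eqP.
  by rewrite paddr_eq0 ?sqr_ge0 // !sqrf_eq0 => /andP[_ /eqP].
have pq1 i j : p i j ^+ 2 + q i j ^+ 2 = 1.
  rewrite /p /q; case: eqP => [_|/eqP h0]; first by rewrite expr1n expr0n addr0.
  by rewrite !expr_div_n -mulrDl fg divff // expf_neq0 // mulf_neq0.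
have a01' i : 0 <= a i <= 1 by have /andP[/ltW-> ->] := a01 i.
apply: le_trans (prod_cos_ge (fun j => c j * \prod_i h i j) a01' pq1) _.
rewrite ler_wpM2l ?ler0n // -subr_ge0 -sumrB.
pose M i j k := h i j * h i k + f i j * f i k + g i j * g i k.
have psdM i : real_psd (M i).
  by apply: real_psdD; first apply: real_psdD; exact: real_psd_rank1.
have [_ /(_ c)] := real_psd_prodB (index_enum I) psdM psdK.
congr (0 <= _); apply: eq_bigr => j _; rewrite -sumrB; apply: eq_bigr => k _.
have -> : \prod_i M i j k = \prod_i h i j * \prod_i h i k *
    \prod_i (1 + a i ^+ 2 * (p i j * p i k + q i j * q i k)).
  by rewrite -!big_split; apply: eq_bigr => i _; rewrite /M !fE !gE /=; ring.
by rewrite mulrBr mulrBl; ring.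
Qed.

(** The left-hand side is the form at [c] of a product of rank one matrices, each dominated by
    [K i]. This bounds the functional whose representer is the tensor product. *)
Lemma prod_rank1_quadratic_le (I : finType) (h : I -> 'I_n -> R)
    (K : I -> 'I_n -> 'I_n -> R) (c : 'I_n -> R) :
  (forall i, real_psd (fun j k => K i j k - h i j * h i k)) ->
  (\sum_j c j * \prod_i h i j) ^+ 2 <=
  \sum_j \sum_k c j * c k * \prod_i K i j k.
Proof.
move=> psdK; have psdh i := real_psd_rank1 (h i).
rewrite -subr_ge0; have [_ /(_ c)] := real_psd_prodB (index_enum I) psdh psdK.
congr (0 <= _); rewrite expr2 mulr_suml -sumrB.
apply: eq_bigr => j _; rewrite mulr_sumr -sumrB; apply: eq_bigr => k _.
by rewrite big_split /=; ring.
Qed.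
End RealPositiveSemidefinite.

(** * Reproducing kernel Hilbert spaces *)

Section RKHS.
Context {R : realType} {D : Type} {F : rkhs R D}.
Implicit Types (u v w : F) (x : D) (s : seq (R * D)).
Local Notation "''[' u , v ]" := (rkhs_dot F u v).

Lemma dotC u v : '[u, v] = '[v, u].
Proof. by rewrite (hermC (rkhs_dot F) u v) expr0 mul1r. Qed.

Lemma dot_ge0 u : 0 <= '[u, u].
Proof.
have [->|u0] := eqVneq u 0; first by rewrite linear0r.
exact/ltW/(neq0_dnorm_gt0 (s := rkhs_dot F)).
Qed.

Lemma norm_dotE u : `|u| ^+ 2 = '[u, u].
Proof. by rewrite rkhs_normE sqr_sqrtr // dot_ge0. Qed.

Lemma dotDl u v w : '[u + v, w] = '[u, w] + '[v, w].
Proof. exact: linearDl. Qed.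
Lemma dotBl u v w : '[u - v, w] = '[u, w] - '[v, w].
Proof. exact: linearBl. Qed.
Lemma dotZl (a : R) u v : '[a *: u, v] = a * '[u, v].
Proof. exact: linearZl_LR. Qed.
Lemma dotDr u v w : '[u, v + w] = '[u, v] + '[u, w].
Proof. exact: linearDr. Qed.
Lemma dotBr u v w : '[u, v - w] = '[u, v] - '[u, w].
Proof. exact: linearBr. Qed.
Lemma dotZr (a : R) u v : '[u, a *: v] = a * '[u, v].
Proof. exact: linearZr_LR. Qed.
Lemma dot_sumr u (I : Type) (r : seq I) (v : I -> F) :
  '[u, \sum_(i <- r) v i] = \sum_(i <- r) '[u, v i].
Proof. exact: linear_sumr. Qed.
Lemma dot_suml u (I : Type) (r : seq I) (v : I -> F) :
  '[\sum_(i <- r) v i, u] = \sum_(i <- r) '[v i, u].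
Proof. by rewrite dotC dot_sumr; apply: eq_bigr => i _; rewrite dotC. Qed.

Lemma cauchy_schwarz u v : '[u, v] ^+ 2 <= '[u, u] * '[v, v].
Proof.
have [->|v0] := eqVneq v 0; first by rewrite !linear0r expr0n.
have vv : 0 < '[v, v] by exact: (@neq0_dnorm_gt0 _ _ _ (rkhs_dot F)).
(* The squared norm expands to ['[v, v]] times the difference of the two sides. *)
have := dot_ge0 ('[v, v] *: u - '[u, v] *: v).
rewrite !(dotBl, dotBr, dotZl, dotZr) (dotC v u) => H.
rewrite -subr_ge0 -(pmulr_rge0 _ vv); move: H; congr (0 <= _); ring.
Qed.

Lemma dot_le u v : `|'[u, v]| <= `|u| * `|v|.
Proof.
rewrite -(ler_pXn2r (n := 2)) ?nnegrE ?mulr_ge0 //.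
by rewrite real_normK ?num_real // exprMn !norm_dotE cauchy_schwarz.
Qed.

Lemma cvg_dot (u_ : nat -> F) u v :
  u_ @ \oo --> u -> (fun k => '[v, u_ k]) @ \oo --> '[v, u].
Proof.
move=> u_u; apply/subr_cvg0/norm_cvg0P.
apply: (@squeeze_cvgr _ _ _ _ (fun=> 0) (fun k => `|v| * `|u_ k - u|)).
- by near=> k; rewrite normr_ge0 -dotBr dot_le.
- exact: cvg_cst.
- rewrite -(mulr0 `|v|); apply: cvgMr; rewrite -(normr0 F); apply: cvg_norm.
  exact/subr_cvg0.
Unshelve. all: by end_near.
Qed.

(** With lists of coefficient-point pairs, addition is concatenation. *)
Definition lincomb s : F := \sum_(p <- s) p.1 *: rkhs_section F p.2.

Lemma dot_lincomb u s : '[u, lincomb s] = \sum_(p <- s) p.1 * rkhs_eval u p.2.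
Proof.
rewrite dot_sumr; apply: eq_bigr => p _.
by rewrite dotZr rkhs_reproducing.
Qed.

Lemma eval_lincomb s x :
  rkhs_eval (lincomb s) x = \sum_(p <- s) p.1 * Defs.kernel F x p.2.
Proof.
rewrite -rkhs_reproducing dot_suml; apply: eq_bigr => p _.
by rewrite dotZl rkhs_reproducing.
Qed.

(** * Riesz representation of functionals given on combinations of sections *)

Section Riesz.
Context (H : D -> R) (c : R).
Local Notation L s := (\sum_(p <- s) p.1 * H p.2).
Context (c_gt0 : 0 < c).
Context (L_bounded : forall s, L s ^+ 2 <= c * '[lincomb s, lincomb s]).

(* The representer minimizes ||u||^2 - 2 L u; here over finite combinations of
   sections only, so that no closed subspace is needed. *)
Let J s := '[lincomb s, lincomb s] - 2 * L s.

(** [c * (J s + c)] is at least [(L s - c) ^+ 2]. *)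
Let J_ge s : - c <= J s.
Proof.
rewrite -subr_ge0 -(pmulr_rge0 _ c_gt0) /J.
by have := L_bounded s; have := sqr_ge0 (L s - c); nra.
Qed.

Let m := inf (range J).

Let has_inf_J : has_inf (range J).
Proof. by split; [exists (J [::]), [::] | exists (- c) => _ [s _ <-]]. Qed.

Let m_le s : m <= J s.
Proof. by apply: ge_inf; [exact: has_inf_J.2 | exists s]. Qed.

Let scale (a : R) s := [seq (a * p.1, p.2) | p <- s].

Let lincomb_scale a s : lincomb (scale a s) = a *: lincomb s.
Proof.
by rewrite /lincomb big_map scaler_sumr; apply: eq_bigr => p _; rewrite scalerA.
Qed.

Let L_scale a s : L (scale a s) = a * L s.
Proof. by rewrite big_map mulr_sumr; apply: eq_bigr => p _; rewrite mulrA. Qed.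

Let lincomb_cat s t : lincomb (s ++ t) = lincomb s + lincomb t.
Proof. by rewrite /lincomb big_cat. Qed.

(** Parallelogram identity, with [J >= m] at the midpoint: near-minimizers are close to each
    other. *)
Let near_min s t : `|lincomb s - lincomb t| ^+ 2 <= 2 * ((J s - m) + (J t - m)).
Proof.
have := m_le (scale 2^-1 (s ++ t)).
rewrite norm_dotE /J lincomb_scale L_scale lincomb_cat big_cat /=.
rewrite !(dotBl, dotBr, dotZl, dotZr, dotDl, dotDr).
rewrite (dotC (lincomb t) (lincomb s)); lra.
Qed.

(** Adding [a] times the section at [x] changes [J] by [a^2 K + 2 a e], where [e] is the residual at
    [x] and [K = K(x, x)]. The step [a = - e / (K + 1)], defined even if [K = 0], would bring [J]
    below [m] if [e] were too large. *)
Let near_eval s x :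
  ('[lincomb s, rkhs_section F x] - H x) ^+ 2 <=
  (Defs.kernel F x x + 1) * (J s - m).
Proof.
set e := _ - H x; have K_ge0 : 0 <= Defs.kernel F x x.
  by rewrite /Defs.kernel -rkhs_reproducing dot_ge0.
have := m_le (s ++ [:: (- e / (Defs.kernel F x x + 1), x)]).
set a := - e / _; have aE : a * (Defs.kernel F x x + 1) = - e.
  by rewrite /a divfK // gt_eqF // ltr_wpDl.
have -> : J (s ++ [:: (a, x)]) = J s + a ^+ 2 * Defs.kernel F x x + 2 * a * e.
  rewrite /J lincomb_cat big_cat {2 4}/lincomb !big_seq1 /=.
  rewrite !(dotDl, dotDr, dotZl, dotZr) (dotC (rkhs_section F x)) /e.
  by rewrite /Defs.kernel -(rkhs_reproducing (rkhs_section F x)); ring.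
move: aE; clearbody a e; move: (Defs.kernel F x x) K_ge0 => K K_ge0 aE Jm.
have eE : e = - (a * (K + 1)) by rewrite aE opprK.
have {}Jm : a ^+ 2 * (K + 2) <= J s - m.
  rewrite eE in Jm; rewrite -subr_ge0; move: Jm; rewrite -subr_ge0.
  by congr (0 <= _); ring.
have -> : e ^+ 2 = (K + 1) * (a ^+ 2 * (K + 1)).
  by rewrite eE; ring.
rewrite ler_wpM2l ?addr_ge0 //; apply: le_trans Jm.
by rewrite ler_wpM2l ?sqr_ge0 // lerD2l ler1n.
Qed.

(** A minimizing sequence is Cauchy by [near_min], and by [near_eval] its residuals vanish in the
    limit. The sequence itself is kept for [lincomb_dense]. *)
Lemma rkhs_riesz : exists u : F, (forall x, rkhs_eval u x = H x) /\
  exists s : nat -> seq (R * D), lincomb \o s @ \oo --> u.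
Proof.
have exS (k : nat) : exists s, J s < m + harmonic k.
  have [_ [s _ <-] ?] := inf_adherent (harmonic_gt0 (R := R) k) has_inf_J.
  by exists s.
have [S JS] := choice exS; pose u_ k := lincomb (S k).
have u_cauchy : cauchy (u_ @ \oo).
  apply: cauchy_exP => e e0.
  (* For [k >= N], [near_min] bounds the squared distance by [2 * (harmonic k + harmonic N)], hence
     by [4 * harmonic N]. *)
  have [N _ HN] : \forall k \near \oo, 4 * harmonic k < e ^+ 2.
    apply: (cvgr_lt (4 * 0)); last by rewrite mulr0 exprn_gt0.
    by apply: cvgMr; exact: cvg_harmonic.
  exists (u_ N); exists N => // k /= Nk; rewrite -ball_normE /=.
  rewrite -(ltr_pXn2r (n := 2)) ?nnegrE ?(ltW e0) //.
  apply: le_lt_trans (HN N (leqnn N)); apply: le_trans (near_min _ _) _.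
  have := JS N; have := JS k.
  have : harmonic k <= harmonic N :> R by rewrite lef_pV2 ?posrE ?ler_nat ?ltnS.
  lra.
have [u u_u] : exists u, u_ @ \oo --> u.
  by exists (lim (u_ @ \oo)); exact: cauchy_cvg.
exists u; split; last by exists S.
move=> x; rewrite -rkhs_reproducing; apply/eqP; rewrite -subr_eq0 -sqrf_eq0.
rewrite eq_le sqr_ge0 andbT.
have lim1 : (fun k => ('[u_ k, rkhs_section F x] - H x) ^+ 2) @ \oo -->
    ('[u, rkhs_section F x] - H x) ^+ 2.
  rewrite expr2; under eq_fun do rewrite expr2.
  have lim : (fun k => '[u_ k, rkhs_section F x] - H x) @ \oo -->
      '[u, rkhs_section F x] - H x.
    apply: cvgB; last exact: cvg_cst.
    by rewrite dotC; under eq_fun do rewrite dotC; exact: cvg_dot.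
  exact: cvgM.
have lim2 :
    (fun k => (Defs.kernel F x x + 1) * (harmonic k : R)) @ \oo --> (0 : R).
  rewrite -(mulr0 (Defs.kernel F x x + 1)).
  by apply: cvgMr; exact: cvg_harmonic.
apply: (ler_cvg_to lim1 lim2); near=> k; apply: le_trans (near_eval _ _) _.
rewrite ler_wpM2l ?addr_ge0 ?/Defs.kernel -?rkhs_reproducing ?dot_ge0 //.
by have := JS k; lra.
Unshelve. all: by end_near.
Qed.

End Riesz.

(** The representer built from the values of [u] is [u] itself, and it comes with approximating
    combinations. The constant ['[u, u] + 1] is positive even for [u = 0]. *)
Lemma lincomb_dense u : exists s : nat -> seq (R * D), lincomb \o s @ \oo --> u.
Proof.
have [|s|v [uv [s sv]]] := rkhs_riesz (H := rkhs_eval u) (c := '[u, u] + 1).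
- by rewrite ltr_wpDl // dot_ge0.
- rewrite -dot_lincomb; apply: le_trans (cauchy_schwarz _ _) _.
  by rewrite ler_wpM2r ?dot_ge0 // lerDl.
exists s; suff -> : u = v by [].
by apply: (@rkhs_eval_inj _ _ F); apply/funext => x; rewrite uv.
Qed.

Lemma real_psd_dot n (v : 'I_n -> F) : real_psd (fun j k => '[v j, v k]).
Proof.
split=> [j k|z]; first exact: dotC.
have -> : \sum_j \sum_k z j * '[v j, v k] * z k =
    '[\sum_j z j *: v j, \sum_j z j *: v j].
  rewrite dot_suml; apply: eq_bigr => j _; rewrite dot_sumr.
  by apply: eq_bigr => k _; rewrite dotZl dotZr; ring.
exact: dot_ge0.
Qed.

(* The kernel of the orthogonal complement of [u], [v] and [w]. *)
Lemma real_psd_kernel_bessel (u v w : F) n (x : 'I_n -> D) :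
  orthonormal (rkhs_dot F) [:: u; v; w] ->
  real_psd (fun j k => Defs.kernel F (x j) (x k) -
    (rkhs_eval u (x j) * rkhs_eval u (x k) +
     rkhs_eval v (x j) * rkhs_eval v (x k) +
     rkhs_eval w (x j) * rkhs_eval w (x k))).
Proof.
rewrite /orthonormal /= !andbT.
move=> /andP[/and3P[/eqP uu /eqP vv /eqP ww]].
move=> /andP[/andP[/eqP uv /eqP uw] /eqP vw].
(* The components of the sections orthogonal to [u], [v] and [w]; their Gram matrix is the matrix in
   question. *)
pose y j := rkhs_section F (x j) - (rkhs_eval u (x j) *: u +
  rkhs_eval v (x j) *: v + rkhs_eval w (x j) *: w).
apply: eq_real_psd (real_psd_dot y) => j k.
rewrite /y !(dotBl, dotBr, dotDl, dotDr, dotZl, dotZr).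
rewrite !(dotC (rkhs_section F _) u, dotC (rkhs_section F _) v,
  dotC (rkhs_section F _) w, dotC v u, dotC w u, dotC w v).
rewrite uu vv ww uv uw vw (dotC (rkhs_section F (x j)) (rkhs_section F (x k))).
by rewrite !rkhs_reproducing /Defs.kernel; ring.
Qed.

(** For [w] nonzero, the unit vector [w / |w|] attains the value [|w|]. *)
Lemma functional_norm_ge (w : F) (T : F -> R) :
  (forall u, T u = '[u, w]) -> (`|w|%:E <= functional_norm T)%E.
Proof.
move=> TE; have [->|w0] := eqVneq w 0.
  rewrite normr0; apply: ereal_sup_ubound; exists 0 => /=.
    by rewrite normr0.
  by rewrite TE linear0l normr0.
apply: ereal_sup_ubound; exists (`|w|^-1 *: w) => /=.
  by rewrite normrZ ger0_norm ?invr_ge0 // mulVf ?normr_eq0.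
rewrite TE dotZl -norm_dotE expr2 mulrA mulVf ?normr_eq0 // mul1r.
by rewrite normr_id.
Qed.

End RKHS.

(** * Tensor products *)

Lemma cvg_prod (R : realType) (I : Type) (r : seq I) (u_ : I -> nat -> R)
    (l : I -> R) :
  (forall i, u_ i @ \oo --> l i) ->
  (fun k => \prod_(i <- r) u_ i k) @ \oo --> \prod_(i <- r) l i.
Proof.
move=> ul; elim: r => [|i r IHr].
  by rewrite big_nil; under eq_fun do rewrite big_nil; exact: cvg_cst.
by rewrite big_cons; under eq_fun do rewrite big_cons; exact: cvgM.
Qed.

Section Tensor.
Context {R : realType} {d : nat} {D : 'I_d -> Type}.

(** Distributivity. [S] encodes the elementary tensor of the combinations [s i]; it does not depend
    on [G], which can thus be the representers as well as the kernels. *)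
Lemma tensor_lincomb (t : forall i, D i) (s : forall i, seq (R * D i)) :
  exists S : seq (R * forall i, D i), forall G : forall i, D i -> R,
    \sum_(p <- S) p.1 * \prod_i G i (p.2 i) =
    \prod_i \sum_(p <- s i) p.1 * G i p.2.
Proof.
(* The lists are padded to a common length with coefficient 0; [t] supplies the points of the
   padding. *)
pose N := \max_i size (s i); pose pt i j := nth (0, t i) (s i) j.
have sN i : (size (s i) <= N)%N by exact: (@leq_bigmax _ (fun i => size (s i))).
exists [seq (\prod_i (pt i (f i)).1, fun i => (pt i (f i)).2) |
  f : {ffun 'I_d -> 'I_N}] => G.
rewrite big_map big_enum /=.
have -> : \prod_i \sum_(p <- s i) p.1 * G i p.2 =
    \prod_i \sum_(j < N) (pt i j).1 * G i (pt i j).2.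
  apply: eq_bigr => i _; rewrite (big_nth (0, t i)) big_mkord.
  rewrite (big_ord_widen _ (fun j => (pt i j).1 * G i (pt i j).2)
    (sN i)) big_mkcond; apply: eq_bigr => j _.
  by case: ltnP => // sj; rewrite /pt nth_default //= mul0r.
rewrite bigA_distr_bigA; apply: eq_bigr => f _.
by rewrite big_split.
Qed.

Context {F : forall i, rkhs R (D i)} {FF : rkhs R (forall i, D i)}.
Context (hFF : is_tensor_product F FF).

(** The hypothesis on [S] is applied once for each argument of the inner product, the kernel of [FF]
    being a product. *)
Lemma dot_tensor_lincomb (s : forall i, seq (R * D i))
    (S : seq (R * forall i, D i)) :
  (forall G : forall i, D i -> R,
    \sum_(p <- S) p.1 * \prod_i G i (p.2 i) =
    \prod_i \sum_(p <- s i) p.1 * G i p.2) ->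
  rkhs_dot FF (lincomb S) (lincomb S) =
  \prod_i rkhs_dot (F i) (lincomb (s i)) (lincomb (s i)).
Proof.
move=> SE; rewrite dot_lincomb.
under [RHS]eq_bigr => i _ do rewrite dot_lincomb.
rewrite -(SE (fun i => rkhs_eval (lincomb (s i)))); apply: eq_bigr => p _.
congr (_ * _); rewrite eval_lincomb.
under [RHS]eq_bigr => i _ do rewrite eval_lincomb.
rewrite -(SE (fun i => Defs.kernel (F i) (p.2 i))).
by apply: eq_bigr => q _; rewrite hFF.
Qed.

(** The default of [xget] is ruled out by Riesz representation: the functional is bounded with
    constant [c], the product of the squared norms. Adding 1 makes the constant positive. *)
Lemma tensor_elt_eval (h : forall i, F i) t :
  rkhs_eval (tensor_elt FF h) t = \prod_i rkhs_eval (h i) (t i).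
Proof.
suff [u uE] : exists u : FF, forall t : forall i, D i,
    rkhs_eval u t = \prod_i rkhs_eval (h i) (t i).
  rewrite /tensor_elt; case: xgetP => [v _ -> //|/(_ u)].
  by move=> /= /(_ uE).
pose c := \prod_i rkhs_dot (F i) (h i) (h i).
have c_ge0 : 0 <= c by apply: prodr_ge0 => i _; exact: dot_ge0.
have [|s|u [uE _]] := @rkhs_riesz R _ FF
  (fun t => \prod_i rkhs_eval (h i) (t i)) (c + 1); last by exists u.
  by rewrite ltr_wpDl.
apply: le_trans (_ : c * rkhs_dot FF (lincomb s) (lincomb s) <= _); last first.
  by rewrite ler_wpM2r ?dot_ge0 // lerDl.
pose x j := tnth (in_tuple s) j.
pose K i j k := rkhs_dot (F i) (h i) (h i) *
  Defs.kernel (F i) ((x j).2 i) ((x k).2 i).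
(* Cauchy-Schwarz for [h i] and a combination of sections with coefficients [z]. *)
have psdK i : real_psd (fun j k => K i j k -
    rkhs_eval (h i) ((x j).2 i) * rkhs_eval (h i) ((x k).2 i)).
  split=> [j k|z].
    rewrite /K /Defs.kernel -!rkhs_reproducing dotC; congr (_ - _).
    by rewrite mulrC.
  have := cauchy_schwarz (h i)
    (lincomb [seq (z j, (x j).2 i) | j <- index_enum 'I_(size s)]).
  rewrite !dot_lincomb !big_map /=.
  rewrite -subr_ge0; congr (0 <= _).
  rewrite mulr_sumr expr2 mulr_suml -sumrB; apply: eq_bigr => j _.
  rewrite eval_lincomb big_map /= !mulr_sumr -sumrB.
  by apply: eq_bigr => k _; rewrite /K; ring.
rewrite [X in X ^+ 2]big_tnth.
apply: le_trans (prod_rank1_quadratic_le (fun j => (x j).1) psdK) _.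
rewrite dot_lincomb [in leRHS]big_tnth mulr_sumr; apply: ler_sum => j _.
rewrite eval_lincomb [in leRHS]big_tnth !mulr_sumr; apply: ler_sum => k _.
by rewrite hFF big_split /= -/c le_eqVlt; apply/orP; left; apply/eqP; ring.
Qed.

(* Tests U = tensor_elt FF h against tensor products of linear combinations of
   sections that converge to the h i. *)
Lemma dot_tensor_elt_ge (h : forall i, F i) (t : forall i, D i) :
  \prod_i rkhs_dot (F i) (h i) (h i) <=
  rkhs_dot FF (tensor_elt FF h) (tensor_elt FF h).
Proof.
set p := \prod_i _; set U := tensor_elt FF h.
have p_ge0 : 0 <= p by apply: prodr_ge0 => i _; exact: dot_ge0.
pose s i := sval (cid (lincomb_dense (h i))).
have s_h i : lincomb \o s i @ \oo --> h i by rewrite /s; case: cid.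
pose a k := \prod_i rkhs_dot (F i) (h i) (lincomb (s i k)).
pose b k := \prod_i rkhs_dot (F i) (lincomb (s i k)) (lincomb (s i k)).
have a_p : a @ \oo --> p by apply: cvg_prod => i; exact: cvg_dot (s_h i).
have b_p : b @ \oo --> p.
  apply: cvg_prod => i; rewrite -norm_dotE expr2.
  under eq_fun do rewrite -norm_dotE expr2.
  by apply: cvgM; apply: cvg_norm (s_h i).
(* Cauchy-Schwarz for [U] and the elementary tensor of the [k]th approximants. *)
have ab k : a k ^+ 2 <= rkhs_dot FF U U * b k.
  have [S SE] := tensor_lincomb t (fun i => s i k).
  have -> : a k = rkhs_dot FF U (lincomb S).
    rewrite /a dot_lincomb; under eq_bigr => i _ do rewrite dot_lincomb.
    rewrite -(SE (fun i => rkhs_eval (h i))); apply: eq_bigr => q _.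
    by rewrite tensor_elt_eval.
  by rewrite /b -(dot_tensor_lincomb SE) cauchy_schwarz.
have a2_p : (fun k => a k ^+ 2) @ \oo --> p ^+ 2.
  by rewrite expr2; under eq_fun do rewrite expr2; exact: cvgM.
have b2_p : (fun k => rkhs_dot FF U U * b k) @ \oo --> rkhs_dot FF U U * p.
  exact: cvgMr.
have pp : p ^+ 2 <= rkhs_dot FF U U * p.
  by apply: (ler_cvg_to a2_p b2_p); near=> k; exact: ab.
have [->|p0] := eqVneq p 0; first exact: dot_ge0.
by move: pp; rewrite expr2 ler_pM2r // lt0r p0.
Unshelve. all: by end_near.
Qed.
End Tensor.

(** * Lower bound for the worst case error *)

Theorem theorem10 (R : realType) (d : nat) (D : 'I_d -> Type)
    (F : forall i : 'I_d, rkhs R (D i)) (h : forall i : 'I_d, F i)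
    (h_unit : forall i : 'I_d, functional_norm (dot_functional (h i)) = 1%E)
    (h_ge0 : forall (i : 'I_d) (x : D i), 0 <= rkhs_eval (h i) x)
    (f g : forall i : 'I_d, F i) (alpha : 'I_d -> R)
    (alpha01 : forall i : 'I_d, 0 < alpha i <= 1)
    (hfg_orthonormal : forall i : 'I_d,
      orthonormal (rkhs_dot (F i)) [:: h i; f i; g i])
    (hfg_eq : forall (i : 'I_d) (x : D i),
      alpha i * rkhs_eval (h i) x =
      Num.sqrt (rkhs_eval (f i) x ^+ 2 + rkhs_eval (g i) x ^+ 2))
    (FF : rkhs R (forall i : 'I_d, D i)) (hFF : is_tensor_product F FF)
    (n : nat) :
  ((1 - n%:R * \prod_(i < d) (1 + alpha i ^+ 2)^-1)%:E <=
    minimal_error n (tensor_functional FF h) ^+ 2)%E.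
Proof.
have hh i : rkhs_dot (F i) (h i) (h i) = 1.
  by have := hfg_orthonormal i; rewrite /orthonormal /= => /andP[/and3P[/eqP]].
(* On an empty domain [h i] would be 0, contradicting its unit norm. The points found here serve as
   [t] in [dot_tensor_elt_ge]. *)
have inhD i : exists x : D i, True.
  apply: contrapT => noD; have h0 : h i = 0.
    by apply: rkhs_eval_inj; apply/funext => x; case: noD; exists x.
  by have /eqP := hh i; rewrite h0 linear0r eq_sym oner_eq0.
pose t i := sval (cid (inhD i)).
set U := tensor_elt FF h.
have U_ge1 : 1 <= rkhs_dot FF U U.
  apply: le_trans (dot_tensor_elt_ge hFF h t).
  by rewrite (eq_bigr (fun=> 1)) ?big1.
set P := \prod_i _.
have P_gt0 : 0 < P.
  by apply: prodr_gt0 => i _; rewrite invr_gt0 ltr_pwDl // sqr_ge0.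
have PV : P^-1 = \prod_i (1 + alpha i ^+ 2).
  by rewrite -prodfV; apply: eq_bigr => i _; rewrite invrK.
have err_ge (x : 'I_n -> forall i, D i) (c : 'I_n -> R) :
    1 - n%:R * P <= `|U - \sum_j c j *: rkhs_section FF (x j)| ^+ 2.
  have := @prod_quadratic_ge R n _ alpha
    (fun i j => rkhs_eval (h i) (x j i)) (fun i j => rkhs_eval (f i) (x j i))
    (fun i j => rkhs_eval (g i) (x j i))
    (fun i j k => Defs.kernel (F i) (x j i) (x k i)) c alpha01
    (fun i j => h_ge0 i (x j i)) (fun i j => hfg_eq i (x j i))
    (fun i => real_psd_kernel_bessel (fun j => x j i) (hfg_orthonormal i)).
  rewrite -PV norm_dotE.
  set T := \sum_j c j * _; set Q := \sum_j \sum_k _ => PTQ.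
  have -> : rkhs_dot FF (U - \sum_j c j *: rkhs_section FF (x j))
      (U - \sum_j c j *: rkhs_section FF (x j)) = rkhs_dot FF U U - 2 * T + Q.
    set v := \sum_j _; rewrite !(dotBl, dotBr) (dotC v U).
    have -> : rkhs_dot FF U v = T.
      rewrite dot_sumr; apply: eq_bigr => j _.
      by rewrite dotZr rkhs_reproducing tensor_elt_eval.
    have -> : rkhs_dot FF v v = Q.
      rewrite dot_suml; apply: eq_bigr => j _; rewrite dot_sumr.
      apply: eq_bigr => k _; rewrite dotZl dotZr dotC rkhs_reproducing.
      by rewrite -/(Defs.kernel _ _ _) mulrA hFF.
    by ring.
  have [n0|n_gt0] := posnP n.
    have no_ord (j : 'I_n) : False by have := leq_trans (ltn_ord j) (eq_leq n0).
    have -> : T = 0 by rewrite /T big1 // => j; case: (no_ord j).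
    have -> : Q = 0 by rewrite /Q big1 // => j; case: (no_ord j).
    by rewrite n0 mul0r mulr0 !subr0 addr0.
  suff : 0 <= n%:R * P - 2 * T + Q by lra.
  rewrite -(pmulr_rge0 _ (_ : 0 < n%:R :> R)) ?ltr0n //.
  (* Since [n Q >= P^-1 T^2], the expression is bounded below by a completed square. *)
  apply: le_trans (_ : P^-1 * (T - n%:R * P) ^+ 2 <= _).
    by rewrite mulr_ge0 ?sqr_ge0 ?invr_ge0 ?ltW.
  have -> : P^-1 * (T - n%:R * P) ^+ 2 =
      P^-1 * T ^+ 2 - 2 * n%:R * T + n%:R ^+ 2 * P.
    by field; rewrite gt_eqF.
  by rewrite -subr_ge0; move: PTQ; rewrite -subr_ge0; congr (0 <= _); ring.
have err_ge' : ((Num.sqrt (1 - n%:R * P))%:E <=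
    minimal_error n (tensor_functional FF h))%E.
  apply: le_ereal_inf_tmp => _ [x _ <-]; apply: le_ereal_inf_tmp => _ [c _ <-].
  (* The representer of the error functional. *)
  pose w := U - \sum_j c j *: rkhs_section FF (x j).
  apply: le_trans (functional_norm_ge (w := w) _).
    rewrite lee_fin -[leRHS]ger0_norm // -sqrtr_sqr.
    by apply: ler_wsqrtr; exact: err_ge.
  move=> u; rewrite dotBr dot_sumr; congr (_ - _); apply: eq_bigr => j _.
  by rewrite dotZr rkhs_reproducing.
apply: le_trans (_ : ((Num.sqrt (1 - n%:R * P))%:E ^+ 2 <= _)%E); last first.
  by rewrite lee_sqr // (le_trans _ err_ge').
(* If [1 - n P] is negative, its [Num.sqrt] is squared to a nonnegative number and the bound is
   trivial. *)
rewrite -EFin_expe lee_fin; have [x0|/ltW x0] := leP 0 (1 - n%:R * P).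
  by rewrite sqr_sqrtr.
by rewrite (le_trans x0) // sqr_ge0.
Qed.
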